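(* Let $G$ be a simple undirected graph. Then the following are equivalent: (1) $G$ is a proper central max-point-tolerance graph; (2) $G$ is a unit central max-point-tolerance graph; (3) $G$ is a proper interval graph.
   Context: Graphs are finite and simple; intervals are closed bounded intervals of the real line. A graph $G=(V,E)$ is a central max-point-tolerance graph (central MPTG) if one can assign to each $u\in V$ an interval $I_u$ with center (midpoint) $c_u$ such that for distinct $u,v\in V$: $uv\in E$ if and only if $\{c_u,c_v\}\subseteq I_u\cap I_v$. It is a proper central MPTG if such an assignment exists in which no interval properly contains another, and a unit central MPTG if such an assignment exists in which all the intervals have the same length. A proper interval graph is an interval graph (vertices assigned intervals, two distinct vertices adjacent if and only if their intervals intersect) having an interval representation in which no interval properly contains another. *)

(* Defs.v *)
From mathcomp Require Import all_boot all_order all_algebra.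
From mathcomp Require Import classical_sets set_interval reals.
Set Implicit Arguments.
Unset Strict Implicit.
Unset Printing Implicit Defensive.
Import Order.TTheory GRing.Theory Num.Theory.
Local Open Scope classical_set_scope.
Local Open Scope ring_scope.

Record sgraph := SGraph {
  vertex :> finType;
  adj : rel vertex;
  adj_sym : symmetric adj;
  adj_irrefl : irreflexive adj }.

(* Nonempty intervals [lo, hi]; a single point (lo = hi) is allowed. *)
Record cinterval (R : realType) := CInterval {
  lo : R;
  hi : R;
  lo_le_hi : lo <= hi }.

Definition cinterval_set (R : realType) (J : cinterval R) : set R :=
  `[lo J, hi J]%classic.
Coercion cinterval_set : cinterval >-> set.

Definition center (R : realType) (J : cinterval R) : R := (lo J + hi J) / 2.

Definition len (R : realType) (J : cinterval R) : R := hi J - lo J.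

(* Distinct vertices may receive the same interval, also in a proper family:
   `<` is strict inclusion of sets. *)
Definition proper_family (R : realType) (V : Type) (I : V -> cinterval R) :=
  forall u v : V, ~ (I u `<` I v).

Definition unit_family (R : realType) (V : Type) (I : V -> cinterval R) :=
  forall u v : V, len (I u) = len (I v).

Definition central_mptg_rep (R : realType) (G : sgraph)
    (I : G -> cinterval R) :=
  forall u v : G, u != v ->
    (adj u v <-> [set center (I u); center (I v)] `<=` I u `&` I v).

Definition interval_rep (R : realType) (G : sgraph) (I : G -> cinterval R) :=
  forall u v : G, u != v -> (adj u v <-> (I u `&` I v) !=set0).

Definition proper_central_mptg (R : realType) (G : sgraph) :=
  exists I : G -> cinterval R, central_mptg_rep I /\ proper_family I.

Definition unit_central_mptg (R : realType) (G : sgraph) :=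
  exists I : G -> cinterval R, central_mptg_rep I /\ unit_family I.

Definition proper_interval_graph (R : realType) (G : sgraph) :=
  exists I : G -> cinterval R, interval_rep I /\ proper_family I.

(* Main.v *)
(** In a proper family the left endpoints, the right endpoints and the centers
    are ordered in the same way, so in either kind of representation adjacency
    is an "umbrella" along this order: if u <= v <= w and u, w are adjacent,
    then v is adjacent to both.  Conversely, given such an order, real points
    are placed one vertex at a time, so that earlier points are smaller and
    two points are at distance < 1 if the vertices are adjacent and > 1
    otherwise; the strict inequalities leave room for the next point.  Closed
    intervals of length 2 (central case) or 1 (intersection case) centered at
    these points represent the graph. *)
Require Import Defs.
From mathcomp Require Import all_boot all_order all_algebra.
From mathcomp Require Import classical_sets set_interval reals.
From mathcomp Require Import lra.
Set Implicit Arguments.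
Unset Strict Implicit.
Unset Printing Implicit Defensive.
Import Order.TTheory GRing.Theory Num.Theory.
Local Open Scope classical_set_scope.
Local Open Scope ring_scope.

Lemma exists_between_lower (R : realFieldType) (l : R) (U : seq R) :
  {in U, forall u, l < u} -> exists2 y, l < y & {in U, forall u, y < u}.
Proof.
elim: U => [|u U IHU] lU; first by exists (l + 1) => //; lra.
have [|y ly yU] := IHU; first by move=> v vU; apply: lU; rewrite inE vU orbT.
have lu : l < u by apply: lU; rewrite mem_head.
exists (Num.min y ((l + u) / 2)); first by rewrite lt_min ly /=; lra.
move=> v; rewrite inE gt_min => /predU1P[->|/yU -> //].
by apply/orP; right; lra.
Qed.

(** Density of the order for finitely many strict bounds, either list possibly empty. Induction on
    [L]: the current [y] is kept if it exceeds the new bound [l], and otherwise moved to a point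
    between [l] and all of [U], which is only larger. *)
Lemma exists_between_seqs (R : realFieldType) (L U : seq R) :
  {in L & U, forall l u, l < u} ->
  exists2 y, {in L, forall l, l < y} & {in U, forall u, y < u}.
Proof.
elim: L => [_|l L IHL LU].
  elim: U => [|u U [y _ yU]]; first by exists 0.
  exists (Num.min y (u - 1)) => // v; rewrite inE gt_min.
  by move=> /predU1P[->|/yU -> //]; apply/orP; right; lra.
have [|y Ly yU] := IHL.
  by move=> k u kL; apply: LU; rewrite inE kL orbT.
have [ly|yl] := ltP l y.
  by exists y => // k; rewrite inE => /predU1P[->|/Ly].
have [|z lz zU] := @exists_between_lower _ l U.
  by move=> u; apply: LU; rewrite mem_head.
exists z => // k; rewrite inE => /predU1P[-> //|/Ly ky].
exact: lt_trans ky (le_lt_trans yl lz).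
Qed.

(** Distinctness is asked of the vertices and not of their values, so the condition also covers ties
    of [f]; it therefore passes to every linear order refining [f]. *)
Definition umbrella (V : Type) (e : rel V) d (T : porderType d) (f : V -> T) :=
  forall u v w : V, u <> v -> v <> w ->
    (f u <= f v)%O -> (f v <= f w)%O -> e u w -> e u v /\ e v w.

Lemma umbrella_points (R : realFieldType) (V : finType) (e : rel V)
    (r : V -> nat) : injective r -> umbrella e r ->
  exists x : V -> R, forall u v, (r u < r v)%N ->
    x u < x v /\ if e u v then x v < x u + 1 else x u + 1 < x v.
Proof.
move=> rI eU.
have eU3 u v w : (r u < r v)%N -> (r v < r w)%N -> e u w -> e u v /\ e v w.
  move=> uv vw; apply: eU; rewrite ?leEnat; try exact: ltnW.
    by move=> euv; rewrite euv ltnn in uv.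
  by move=> evw; rewrite evw ltnn in vw.
(* Induction on a bound [n] for the ranks already placed. The values of [r] may have gaps, in which
   case no vertex has rank [n] and [x] is kept. *)
suff /(_ (\max_v r v).+1)[x xP] : forall n, exists x : V -> R,
    forall u v, (r u < r v)%N -> (r v < n)%N ->
    x u < x v /\ if e u v then x v < x u + 1 else x u + 1 < x v.
  by exists x => u v uv; apply: xP => //; rewrite ltnS leq_bigmax.
elim=> [|n [x xP]]; first by exists (fun=> 0).
have [/existsP[w /eqP rw]|/existsPn no_w] := boolP [exists w, r w == n];
    last first.
  exists x => u v uv; rewrite ltnS leq_eqVlt (negbTE (no_w v)) /=; exact: xP.
(* The new point must exceed all earlier points and stay more than 1 above the earlier
   non-neighbours of [w], but less than 1 above its earlier neighbours. *)
pose L := [seq x u | u <- enum V & (r u < n)%N] ++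
          [seq x u + 1 | u <- enum V & (r u < n)%N && ~~ e u w].
pose U := [seq x u + 1 | u <- enum V & (r u < n)%N && e u w].
have [|y Ly yU] := @exists_between_seqs R L U.
  (* Here [v] is an earlier neighbour of [w]. If [u] lies between [v] and [w], the umbrella makes
     [u] adjacent to both: then [x u < x v + 1], and [u] cannot be a non-neighbour of [w]. *)
  move=> l z lL /mapP[v + ->]; rewrite mem_filter => /andP[/andP[vn evw] _].
  move: lL; rewrite mem_cat => /orP[] /mapP[u + ->]; rewrite mem_filter.
    move=> /andP[un _]; have [uv|vu|/rI ->] := ltngtP (r u) (r v).
    - have [+ _] := xP _ _ uv vn; lra.
    - have [euv _] : e v u /\ e u w by apply: eU3; rewrite ?rw.
      by have [_] := xP _ _ vu un; rewrite euv.
    - lra.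
  move=> /andP[/andP[un /negP euw] _].
  have [uv|vu|/rI euv] := ltngtP (r u) (r v).
  - have [+ _] := xP _ _ uv vn; lra.
  - by have [] : e v u /\ e u w by apply: eU3; rewrite ?rw.
  - by rewrite euv in euw.
exists (fun u => if r u == n then y else x u) => u v uv.
rewrite ltnS leq_eqVlt => /predU1P[rv|vn]; last first.
  by rewrite !ltn_eqF ?(ltn_trans uv) //; apply: xP.
have un : (r u < n)%N by rewrite -rv.
have -> : v = w by apply: rI; rewrite rv rw.
rewrite rw eqxx ltn_eqF //; split.
  by apply: Ly; rewrite mem_cat map_f // mem_filter un mem_enum.
case: ifP => euw.
  by apply: yU; apply: map_f; rewrite mem_filter un euw mem_enum.
apply: Ly; rewrite mem_cat; apply/orP; right.
by apply/mapP; exists u => //; rewrite mem_filter un euw mem_enum.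
Qed.

(** Ties of [f] are broken by the position in a sorted enumeration of [V]. *)
Lemma exists_linear_extension (V : finType) d (T : orderType d) (f : V -> T) :
  exists2 r : V -> nat, injective r &
    forall u v, (r u <= r v)%N -> (f u <= f v)%O.
Proof.
pose s := sort (fun u v => f u <= f v)%O (enum V).
have ss u : u \in s by rewrite mem_sort mem_enum.
exists (fun u => index u s) => [u v|u v]; first exact: index_inj.
apply: (@sorted_leq_index _ (fun u v => f u <= f v)%O) => //.
- by move=> ? ? ?; apply: le_trans.
- by apply: sort_sorted => ? ?; apply: le_total.
Qed.

(** An indifference graph representation, through which all the implications from the proper classes
    pass. *)
Definition unit_distance_rep (R : realType) (G : sgraph) (c : G -> R) :=
  forall u v : G, u != v -> adj u v = (`|c u - c v| <= 1).

Lemma umbrella_unit_distance_rep (R : realType) (G : sgraph) (f : G -> R) :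
  umbrella (@adj G) f -> exists c : G -> R, unit_distance_rep c.
Proof.
move=> fU; have [r rI rf] := exists_linear_extension f.
have [|c cP] := @umbrella_points R _ (@adj G) r rI.
  by move=> u v w uv vw ruv rvw; apply: fU => //; apply: rf.
exists c.
suff rep u v : (r u < r v)%N -> adj u v = (`|c u - c v| <= 1).
  move=> u v uv; have [|?|/rI euv] := ltngtP (r u) (r v); first exact: rep.
    by rewrite adj_sym distrC; exact: rep.
  by rewrite euv eqxx in uv.
move=> /cP[cuv]; rewrite ltr0_norm; last lra.
by case: ifP => _ H; apply/esym; [apply/idP|apply/negbTE; rewrite -ltNge]; lra.
Qed.

Section Intervals.
Variables (R : realType) (V : Type).
Implicit Types (I : V -> cinterval R) (J K : cinterval R) (x c h : R).

Lemma in_cinterval J x : (J : set R) x <-> lo J <= x <= hi J.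
Proof. by rewrite /cinterval_set /= in_itv. Qed.

Lemma subset_cinterval J K :
  (J : set R) `<=` (K : set R) <-> lo K <= lo J /\ hi J <= hi K.
Proof.
have := lo_le_hi J => JJ; split=> [JK|[lKJ hJK] x].
  have /in_cinterval/andP[] : (K : set R) (lo J).
    by apply/JK/in_cinterval; rewrite lexx.
  have /in_cinterval/andP[] : (K : set R) (hi J).
    by apply/JK/in_cinterval; rewrite JJ lexx.
  by [].
by move/in_cinterval=> ?; apply/in_cinterval; lra.
Qed.

Lemma cinterval_meet J K :
  (J : set R) `&` (K : set R) !=set0 <-> (lo K <= hi J) && (lo J <= hi K).
Proof.
have := lo_le_hi J; have := lo_le_hi K => KK JJ; split.
  by move=> [x [/in_cinterval ? /in_cinterval ?]]; lra.
move=> /andP[KJ JK]; exists (Num.max (lo J) (lo K)).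
by split; apply/in_cinterval; rewrite le_max ge_max ?lexx ?orbT; lra.
Qed.

(** Each center lies in its own interval, so only the two cross memberships remain. *)
Lemma centers_subset J K :
  [set center J; center K] `<=` (J : set R) `&` (K : set R) <->
  (lo K <= center J <= hi K) && (lo J <= center K <= hi J).
Proof.
have := lo_le_hi J; have := lo_le_hi K => KK JJ; split.
  move=> sub; have [_ /in_cinterval ->] := sub _ (or_introl erefl).
  by have [/in_cinterval ->] := sub _ (or_intror erefl).
move=> /andP[jK kJ] _ [] ->; split; apply/in_cinterval => //;
  rewrite /center; lra.
Qed.

Lemma proper_family_hi I u v :
  proper_family I -> lo (I u) <= lo (I v) -> hi (I u) <= hi (I v).
Proof.
move=> IP uv; rewrite leNgt; apply/negP => vu; apply: (IP v u); split.
  by apply/subset_cinterval; split=> //; exact: ltW.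
by move=> /subset_cinterval[_]; rewrite leNgt vu.
Qed.

Lemma unit_proper_family I : unit_family I -> proper_family I.
Proof.
move=> IU u v [/subset_cinterval[luv huv]]; apply; apply/subset_cinterval.
by move: (IU u v); rewrite /len; split; lra.
Qed.

Lemma ball_lo_le_hi c h : c - `|h| <= c + `|h|.
Proof. by have := normr_ge0 h; lra. Qed.

(* The radius is [`|h|], so that no sign condition on [h] is needed. *)
Definition ball_cinterval h c : cinterval R := CInterval (ball_lo_le_hi c h).

Lemma unit_family_ball h (c : V -> R) :
  unit_family (fun u => ball_cinterval h (c u)).
Proof. by move=> u v; rewrite /len /=; lra. Qed.

End Intervals.

Section Representations.
Variables (R : realType) (G : sgraph).
Implicit Types (I : G -> cinterval R) (c : G -> R).

Lemma adj_neq (u v : G) : adj u v -> u != v.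
Proof. by apply: contraTneq => ->; rewrite adj_irrefl. Qed.

(** Adjacency of [u] and [w] puts the center of [u] above [lo (I w)] and that of [w] below
    [hi (I u)]. Left endpoints, centers and right endpoints all increase from [u] to [v] to [w], so
    these bounds carry over to both pairs with [v]. *)
Lemma central_rep_umbrella I : central_mptg_rep I -> proper_family I ->
  umbrella (@adj G) (fun u => lo (I u)).
Proof.
move=> rep IP u v w /eqP uv /eqP vw luv lvw euw.
have huv := proper_family_hi IP luv; have hvw := proper_family_hi IP lvw.
have /rep := adj_neq euw; rewrite euw => -[/(_ isT)/centers_subset + _].
rewrite /center => ?; have := lo_le_hi (I u); have := lo_le_hi (I v).
by have := lo_le_hi (I w); split;
  apply/rep => //; apply/centers_subset; rewrite /center; lra.
Qed.

(** From [lo (I w) <= hi (I u)], monotonicity gives [lo (I v) <= hi (I u)] and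
    [lo (I w) <= hi (I v)]. *)
Lemma interval_rep_umbrella I : interval_rep I -> proper_family I ->
  umbrella (@adj G) (fun u => lo (I u)).
Proof.
move=> rep IP u v w /eqP uv /eqP vw luv lvw euw.
have huv := proper_family_hi IP luv; have hvw := proper_family_hi IP lvw.
have /rep := adj_neq euw; rewrite euw => -[/(_ isT)/cinterval_meet ? _].
have := lo_le_hi (I u); have := lo_le_hi (I v).
by have := lo_le_hi (I w); split;
  apply/rep => //; apply/cinterval_meet; lra.
Qed.

Lemma unit_distance_central_rep c : unit_distance_rep c ->
  central_mptg_rep (fun u => ball_cinterval 1 (c u)).
Proof.
move=> cP u v /cP ->; rewrite centers_subset /center /= normr1 ler_norml.
by split=> ?; lra.
Qed.

Lemma unit_distance_interval_rep c : unit_distance_rep c ->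
  interval_rep (fun u => ball_cinterval (1 / 2) (c u)).
Proof.
move=> cP u v /cP ->; rewrite cinterval_meet /= [`|1 / 2|]ger0_norm; last lra.
by rewrite ler_norml; split=> ?; lra.
Qed.

Lemma unit_distance_unit_central c :
  unit_distance_rep c -> unit_central_mptg R G.
Proof.
move=> /unit_distance_central_rep rep; eexists; split; first exact: rep.
exact: unit_family_ball.
Qed.

Lemma unit_distance_proper_interval c :
  unit_distance_rep c -> proper_interval_graph R G.
Proof.
move=> /unit_distance_interval_rep rep; eexists; split; first exact: rep.
exact/unit_proper_family/unit_family_ball.
Qed.

Lemma unit_central_proper : unit_central_mptg R G -> proper_central_mptg R G.
Proof. by move=> [I [rep /unit_proper_family IP]]; exists I. Qed.

Lemma proper_central_unit_distance :
  proper_central_mptg R G -> exists c : G -> R, unit_distance_rep c.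
Proof.
by move=> [I [rep /(central_rep_umbrella rep)]];
  exact: umbrella_unit_distance_rep.
Qed.

Lemma proper_interval_unit_distance :
  proper_interval_graph R G -> exists c : G -> R, unit_distance_rep c.
Proof.
by move=> [I [rep /(interval_rep_umbrella rep)]];
  exact: umbrella_unit_distance_rep.
Qed.

End Representations.

Theorem theorem3p12 (R : realType) (G : sgraph) :
  (proper_central_mptg R G <-> unit_central_mptg R G) /\
  (unit_central_mptg R G <-> proper_interval_graph R G).
Proof.
split; split.
- by move=> /proper_central_unit_distance[c /unit_distance_unit_central].
- exact: unit_central_proper.
- move=> /unit_central_proper/proper_central_unit_distance[c].
  exact: unit_distance_proper_interval.
- by move=> /proper_interval_unit_distance[c /unit_distance_unit_central].
Qed.
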